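(* Let $\theta>0$, $\nu>0$, $k\in\mathbb{N}^+$, and put $$y=\frac{\sqrt{1+\theta^2\nu^2}-1}{\theta\nu},\qquad \xi_\ell=\frac{2\pi(\ell-1)}{2k+1}\quad(1\le\ell\le 2k+1).$$ Let $M=(I-\theta\nu L)^{-1}(I+(1-\theta)\nu L)\in\mathbb{R}^{(2k+1)\times(2k+1)}$. Then $$\frac{1}{2k+1}\sum_{\ell=1}^{2k+1}\frac{1+\imath(1-\theta)\nu\sin(\xi_\ell)}{1-\imath\theta\nu\sin(\xi_\ell)}=M_{1,1}=\frac{\mathcal{P}_{1,k}}{\mathcal{D}_k}=\frac{-\theta y^{4k+4}-(\theta-2)y^{4k+2}+(\theta-2)y^2+\theta}{\left(1+y^2\right)\left(1-y^{4k+2}\right)\theta}.$$ Moreover, for $j=2,3,\ldots,2k+1$, $$\frac{1}{2k+1}\sum_{\ell=1}^{2k+1}\frac{1+\imath(1-\theta)\nu\sin(\xi_\ell)}{1-\imath\theta\nu\sin(\xi_\ell)}\exp\left(-\imath(j-1)\xi_\ell\right)=M_{1,j}=\frac{\mathcal{P}_{j,k}}{\mathcal{D}_k}$$ $$=\frac{\nu\left(1-y^2\right)^2}{2\left(1+y^2\right)\left(1-y^{4k+2}\right)}\Big((-1)^{j-1}y^{4k+2-j}+y^{2k-1+j}+(-1)^jy^{2k+1-j}+y^{j-2}\Big).$$ In particular, $$\prod_{\ell=1}^{2k+1}\bigl(1-\imath\theta\nu\sin(\xi_\ell)\bigr)=\mathcal{D}_k=\left(\frac{\sqrt{1+\thet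a^2\nu^2}+1}{2}\right)^{2k+1}-\left(\frac{\sqrt{1+\theta^2\nu^2}-1}{2}\right)^{2k+1}=\frac{1-y^{4k+2}}{\left(1-y^2\right)^{2k+1}}.$$
   Context: $\imath$ is the complex imaginary unit, $\mathbb{N}^+$ the set of positive integers, $I$ the identity matrix. $L\in\mathbb{R}^{m\times m}$ with $m=2k+1$ is the circulant matrix with, indices modulo $m$, $L_{i,i+1}=\frac12$, $L_{i,i-1}=-\frac12$ ($1\le i\le m$), and all other entries $0$. $\mathcal{D}_k:=\det(I-\theta\nu L)$, and $\mathcal{P}_{j,k}$ denotes the numerator of $M_{1,j}$ over the denominator $\mathcal{D}_k$, i.e. $\mathcal{P}_{j,k}:=\mathcal{D}_kM_{1,j}$ (a polynomial in $\theta$ and $\nu$). *)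

(* Defs.v *)
From HB Require Import structures.
From mathcomp Require Import all_boot all_order all_algebra.
From mathcomp Require Import reals sequences exp trigo.
From mathcomp Require Import complex.
Set Implicit Arguments.
Unset Strict Implicit.
Unset Printing Implicit Defensive.
Import Order.TTheory GRing.Theory Num.Theory.
Local Open Scope ring_scope.
Local Open Scope complex_scope.

(* Complex exponential: exp (a + i b) = e^a (cos b + i sin b). *)
Definition cexp (R : realType) (z : R[i]) : R[i] :=
  (expR (complex.Re z))%:C * (cos (complex.Im z) +i* sin (complex.Im z)).

(* [ordS i] and [ord_pred i] are i + 1 and i - 1 modulo the dimension; they
   are distinct because the dimension 2k + 1 is at least 3 when k > 0. *)
Definition Lmx (R : realType) (k : nat) : 'M[R]_((2 * k).+1) :=
  \matrix_(i, j) (if j == ordS i then 1 / 2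
                  else if j == ord_pred i then - (1 / 2) else 0).

Definition Mmx (R : realType) (theta nu : R) (k : nat) : 'M[R]_((2 * k).+1) :=
  invmx (1%:M - (theta * nu) *: Lmx R k)
    *m (1%:M + ((1 - theta) * nu) *: Lmx R k).

(* Entry of [Mmx] with the 1-based indices i, j in {1, ..., 2k + 1}. *)
Definition Mentry (R : realType) (theta nu : R) (k i j : nat) : R :=
  Mmx theta nu k (inord i.-1) (inord j.-1).

Definition calD (R : realType) (theta nu : R) (k : nat) : R :=
  \det (1%:M - (theta * nu) *: Lmx R k).

Definition calP (R : realType) (theta nu : R) (j k : nat) : R :=
  calD theta nu k * Mentry theta nu k 1 j.

(* Main.v *)
Require Import Defs.
From HB Require Import structures.
From mathcomp Require Import all_boot all_order all_algebra.
From mathcomp Require Import reals sequences exp trigo.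
From mathcomp Require Import complex.
From mathcomp Require Import zify ring lra.
Set Implicit Arguments.
Unset Strict Implicit.
Unset Printing Implicit Defensive.
Import Order.TTheory GRing.Theory Num.Theory.
Local Open Scope ring_scope.
Local Open Scope complex_scope.

(** Write n = 2k + 1, t = theta nu, let T be the cyclic shift (ones at the
    entries (i, i + 1) modulo n) and w = exp(2 i pi / n).  Since
    L = (T - T^-1) / 2, the Fourier vectors (w^(l p))_p are eigenvectors of L,
    with eigenvalues (z - z^-1) / 2 = i sin(xi_(l+1)) where z = w^l, and hence
    of every matrix in the statement.  Determinants are then products of
    eigenvalues ([has_symbol_det]), and orthogonality of the roots of unity
    turns entries into Fourier sums ([has_symbol_entry]); this gives the
    trigonometric product and sums.

    The closed forms come from one factorization.  The number y satisfies
    t = 2 y / (1 - y^2) and 0 < y < 1, so that ([symbol_factor])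

      1 - t (z - 1/z) / 2 = (1 - y z) (1 + y / z) / (1 - y^2).

    The product over z^n = 1 of the first factor is 1 - y^n, that of the second
    is 1 - (-y)^n = 1 + y^n as n is odd, whence the determinant
    ([calD_closed]).  For the entries, M = (1 - 1/theta) I + A^-1 / theta with
    A = I - t L, and the partial fractions

      (1 + y^2) / ((1 - y z) (1 + y / z)) = 1 / (1 - y z) + 1 / (1 + y / z) - 1

    reduce A^-1 to geometric series in z and 1/z, which are finite because
    z^n = 1; reading off the coefficient of z^q gives the entry (1, q + 1)
    ([sum_symbol_inverse], [Mmx_entry_closed]). *)

(** * Sums and products over the roots of unity *)

Lemma prim_root_neq0 (F : fieldType) (n : nat) (w : F) :
  n.-primitive_root w -> w != 0.
Proof.
move=> pw; apply/eqP=> w0; have := prim_expr_order pw.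
rewrite w0 expr0n gtn_eqF ?(prim_order_gt0 pw) //= => /eqP.
by rewrite eq_sym oner_eq0.
Qed.

(** For p <> q the sum is geometric, of ratio x = w^(p - q) with x <> 1 and
    x^n = 1, hence zero. *)
Lemma prim_root_orthogonality (F : fieldType) (n : nat) (w : F) (p q : 'I_n) :
  n.-primitive_root w ->
  \sum_(l < n) (w ^+ l) ^+ p * (w ^+ l) ^- q = if p == q then n%:R else 0.
Proof.
move=> pw; have w0 := prim_root_neq0 pw.
have E (l : 'I_n) : (w ^+ l) ^+ p * (w ^+ l) ^- q = (w ^+ p / w ^+ q) ^+ l.
  by rewrite exprMn exprVn !(exprAC _ l).
rewrite (eq_bigr _ (fun l _ => E l)); case: eqP => [->|/eqP pq].
  rewrite divff ?expf_neq0 // (eq_bigr (fun=> 1)) ?sumr_const ?card_ord //.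
  by move=> l _; rewrite expr1n.
set x := w ^+ p / w ^+ q.
have x1 : x - 1 != 0.
  rewrite subr_eq0; apply: contra pq => /eqP x1.
  have /eqP : w ^+ p = w ^+ q.
    by rewrite -(divfK (expf_neq0 q w0) (w ^+ p)) -/x x1 mul1r.
  by rewrite (eq_prim_root_expr pw) !modn_small.
apply: (mulfI x1); rewrite mulr0 -subrX1 exprMn exprVn !(exprAC _ _ n).
by rewrite !(prim_expr_order pw) !expr1n divr1 subrr.
Qed.

(** For u <> 0, this is u^n times the factorization of X^n - 1 evaluated at
    1 / u. *)
Lemma prod_one_sub_prim_root (F : fieldType) (n : nat) (w u : F) :
  n.-primitive_root w -> \prod_(l < n) (1 - u * w ^+ l) = 1 - u ^+ n.
Proof.
move=> pw; have n0 := prim_order_gt0 pw.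
case: (eqVneq u 0) => [->|u0].
  rewrite expr0n gtn_eqF //= subr0 big1 // => l _; by rewrite mul0r subr0.
have := congr1 (fun p => p.[u^-1]) (factor_Xn_sub_1 pw).
rewrite big_mkord horner_prod !hornerE => H.
have -> : 1 - u ^+ n = u ^+ n * ((u^-1) ^+ n - 1).
  by rewrite mulrBr mulr1 exprVn mulfV ?expf_neq0.
rewrite -H -[in X in X * _](card_ord n) -prodr_const -big_split /=.
by apply: eq_bigr => l _; rewrite !hornerE mulrBr divff.
Qed.

(** On z^n = 1 the geometric series folds up to
    1 / (1 - u z) = sum_(p < n) u^p z^p / (1 - u^n); pairing with z^-q extracts
    the coefficient of z^q. *)
Lemma sum_geometric_prim_root (F : fieldType) (n : nat) (w u : F) (q : 'I_n) :
  n.-primitive_root w -> u ^+ n != 1 ->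
  \sum_(l < n) (1 - u * w ^+ l)^-1 * (w ^+ l) ^- q
    = n%:R * (u ^+ q / (1 - u ^+ n)).
Proof.
move=> pw un; have un' : 1 - u ^+ n != 0 by rewrite subr_eq0 eq_sym.
have E (l : 'I_n) : (1 - u * w ^+ l)^-1 * (w ^+ l) ^- q
    = \sum_(p < n) u ^+ p / (1 - u ^+ n) * ((w ^+ l) ^+ p * (w ^+ l) ^- q).
  have G : 1 - u ^+ n = (1 - u * w ^+ l) * \sum_(p < n) (u * w ^+ l) ^+ p.
    rewrite -[RHS]opprK -mulNr opprB -subrX1 opprB exprMn (exprAC _ l n).
    by rewrite (prim_expr_order pw) expr1n mulr1.
  have d0 : 1 - u * w ^+ l != 0.
    by apply: contraNneq un' => d0; rewrite G d0 mul0r.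
  have -> : (1 - u * w ^+ l)^-1
      = (\sum_(p < n) (u * w ^+ l) ^+ p) / (1 - u ^+ n).
    by apply: (mulfI d0); rewrite mulrA -G !divff.
  rewrite !mulr_suml; apply: eq_bigr => p _; rewrite exprMn; ring.
rewrite (eq_bigr _ (fun l _ => E l)) exchange_big /=.
under eq_bigr => p _ do rewrite -mulr_sumr prim_root_orthogonality //.
rewrite (bigD1 q) //= eqxx big1 ?addr0 1?[RHS]mulrC // => p /negPf ->.
by rewrite mulr0.
Qed.

(** * Matrices diagonal in the Fourier basis *)

Definition fourier_vec (F : fieldType) (n : nat) (w : F) (l : 'I_n) :
    'cV[F]_n :=
  \col_i (w ^+ l) ^+ i.

(** For [w] primitive, [A] is the circulant matrix whose symbol takes the value
    [d l] at [w ^+ l].  The eigenvector form makes symbols compose under matrix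
    operations without any reference to the inverse Fourier matrix. *)
Definition has_symbol (F : fieldType) (n : nat) (w : F) (A : 'M[F]_n)
    (d : 'I_n -> F) :=
  forall l, A *m fourier_vec w l = d l *: fourier_vec w l.

Lemma has_symbol_mulE (F : fieldType) (n : nat) (w : F) (A : 'M[F]_n)
    (d : 'I_n -> F) (i l : 'I_n) : has_symbol w A d ->
  \sum_j A i j * (w ^+ l) ^+ j = d l * (w ^+ l) ^+ i.
Proof.
move=> /(_ l) /matrixP /(_ i ord0); rewrite !mxE => <-.
by apply: eq_bigr => j _; rewrite mxE.
Qed.

(** Fourier inversion: orthogonality of the eigenvectors recovers an entry of
    [A] from the values of [A] on them. *)
Lemma has_symbol_entry (F : fieldType) (n : nat) (w : F) (A : 'M[F]_n)
    (d : 'I_n -> F) (i j : 'I_n) : n.-primitive_root w -> has_symbol w A d ->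
  A i j = n%:R^-1 * \sum_(l < n) d l * (w ^+ l) ^+ i * (w ^+ l) ^- j.
Proof.
move=> pw sA; apply: (mulfI (prim_root_natf_neq0 pw)).
rewrite mulVKf ?(prim_root_natf_neq0 pw) //.
under eq_bigr => l _ do rewrite -(has_symbol_mulE i l sA) mulr_suml.
rewrite exchange_big /=.
under eq_bigr => p _ do
  (under eq_bigr => l _ do rewrite -mulrA;
   rewrite -mulr_sumr prim_root_orthogonality //).
rewrite (bigD1 j) //= eqxx big1 ?addr0 1?mulrC // => p /negPf ->.
by rewrite mulr0.
Qed.

Lemma has_symbol_det (F : fieldType) (n : nat) (w : F) (A : 'M[F]_n)
    (d : 'I_n -> F) : n.-primitive_root w -> has_symbol w A d ->
  \det A = \prod_(l < n) d l.
Proof.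
move=> pw sA.
(* [V] has the eigenvectors as columns; it is invertible because [W] is its
   inverse up to the factor n, which is nonzero by primitivity of [w]. *)
pose V : 'M[F]_n := \matrix_(i, l) (w ^+ l) ^+ i.
pose W : 'M[F]_n := \matrix_(l, j) (w ^+ l) ^- j.
have VW : W^T *m V^T = n%:R%:M.
  apply/matrixP => i j; rewrite !mxE [i == j]eq_sym.
  under eq_bigr => l _ do rewrite !mxE mulrC.
  by rewrite prim_root_orthogonality //; case: eqP.
have dV : \det V != 0.
  have : \det (W^T *m V^T) != 0.
    by rewrite VW det_scalar expf_neq0 ?(prim_root_natf_neq0 pw).
  by rewrite det_mulmx !det_tr mulf_eq0 negb_or => /andP[].
have AV : A *m V = V *m diag_mx (\row_l d l).
  apply/matrixP => i l; rewrite mul_mx_diag !mxE mulrC.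
  rewrite -(has_symbol_mulE i l sA).
  by apply: eq_bigr => j _; rewrite mxE.
have /(congr1 determinant) := AV.
rewrite !det_mulmx det_diag mulrC => /(mulfI dV) ->.
by apply: eq_bigr => l _; rewrite mxE.
Qed.

Lemma has_symbol_unit (F : fieldType) (n : nat) (w : F) (A : 'M[F]_n)
    (d : 'I_n -> F) : n.-primitive_root w -> has_symbol w A d ->
  (A \in unitmx) = [forall l, d l != 0].
Proof.
move=> pw sA; rewrite unitmxE (has_symbol_det pw sA) unitfE.
apply/prodf_neq0/forallP => H l; first exact: H.
by move=> _; exact: H.
Qed.

Lemma has_symbol_affine (F : fieldType) (n : nat) (w a : F) (A : 'M[F]_n)
    (d : 'I_n -> F) : has_symbol w A d ->
  has_symbol w (1%:M + a *: A) (fun l => 1 + a * d l).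
Proof.
by move=> sA l; rewrite mulmxDl mul1mx -scalemxAl sA scalerA scalerDl scale1r.
Qed.

Lemma has_symbol_mulV (F : fieldType) (n : nat) (w : F) (A B : 'M[F]_n)
    (a b : 'I_n -> F) : n.-primitive_root w -> A \in unitmx ->
  has_symbol w A a -> has_symbol w B b ->
  has_symbol w (invmx A *m B) (fun l => b l / a l).
Proof.
move=> pw uA sA sB l; rewrite -mulmxA sB -scalemxAr.
have a0 : a l != 0 by move: uA; rewrite (has_symbol_unit pw sA) => /forallP.
have -> : invmx A *m fourier_vec w l = (a l)^-1 *: fourier_vec w l.
  by apply: (scalerI a0); rewrite scalerA mulfV // scale1r scalemxAr -sA mulKmx.
by rewrite scalerA.
Qed.

(** * The root of unity exp(2 i pi / n) *)

Definition cis (R : realType) (x : R) : R[i] := cos x +i* sin x.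

Lemma cisD (R : realType) (x y : R) : cis (x + y) = cis x * cis y.
Proof. by rewrite /cis cosD sinD [sin x * _ + _]addrC. Qed.

Lemma cisMn (R : realType) (x : R) (m : nat) : cis (x *+ m) = cis x ^+ m.
Proof.
elim: m => [|m IHm]; first by rewrite mulr0n expr0 /cis cos0 sin0.
by rewrite mulrS cisD IHm exprS.
Qed.

Lemma cisN (R : realType) (x : R) : cis (- x) = (cis x)^-1.
Proof.
have H : cis x * cis (- x) = 1 by rewrite -cisD subrr /cis cos0 sin0.
have c0 : cis x != 0.
  by apply: contra_eq_neq H => ->; rewrite mul0r eq_sym oner_eq0.
by apply: (mulfI c0); rewrite H mulfV.
Qed.

(** The real part is 1 - 2 sin^2(x / 2), and the sine does not vanish strictly
    between 0 and pi. *)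
Lemma cis_neq1 (R : realType) (x : R) : 0 < x < pi *+ 2 -> cis x != 1.
Proof.
move=> /andP[x0 x2]; rewrite eq_complex negb_and /=; apply/orP; left.
have s0 : 0 < sin (x / 2) by apply: sin_gt0_pi; lra.
have -> : cos x = 1 - sin (x / 2) ^+ 2 *+ 2.
  have {1}-> : x = (x / 2) *+ 2 by lra.
  by rewrite cos_mulr2n cos2sin2; ring.
by rewrite lt_eqF // ltrBlDr ltrDl pmulrn_lgt0 // exprn_gt0.
Qed.

Lemma cis_prim_root (R : realType) (n : nat) : (0 < n)%N ->
  n.-primitive_root (cis (pi *+ 2 / n%:R : R)).
Proof.
move=> n0; apply/andP; split => //; apply/forallP => i; rewrite unity_rootE.
have nR : 0 < n%:R :> R by rewrite ltr0n.
have p0 : 0 < pi *+ 2 :> R by rewrite mulr2n addr_gt0 ?pi_gt0.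
rewrite -cisMn; apply/eqP; case: (ltngtP i.+1 n) => [lt_in||].
- apply/negbTE/cis_neq1; rewrite -[(_ / _) *+ _]mulr_natr mulrAC.
  apply/andP; split.
    by rewrite divr_gt0 // mulr_gt0 ?ltr0n.
  by rewrite ltr_pdivrMr // ltr_pM2l ?ltr_nat.
- by rewrite ltnNge ltn_ord.
- move=> ->; rewrite -[(_ / _) *+ _]mulr_natr divfK ?lt0r_neq0 //.
  by rewrite /cis cos2pi sin2pi eqxx.
Qed.

Lemma sin_cis (R : realType) (x : R) :
  'i * (sin x)%:C = (cis x - (cis x)^-1) / 2.
Proof.
have two0 : 2 != 0 :> R[i] by rewrite pnatr_eq0.
apply: (mulIf two0); rewrite divfK // mulr_natr mulr2n -cisN /cis cosN sinN.
apply/eqP; rewrite eq_complex /=.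
by rewrite !(mul0r, mul1r, subr0, add0r, mulr0, subrr, opprK, addr0,
           oppr0) !eqxx.
Qed.

(** The Fourier phases of the theorem are negative powers of points of the unit
    circle. *)
Lemma cexp_cis (R : realType) (x : R) (m : nat) :
  cexp (- 'i * m%:R * x%:C) = (cis x) ^- m.
Proof.
have -> : - 'i * m%:R * x%:C = 'i * (- (x *+ m))%:C.
  by rewrite rmorphN /= rmorphMn /= -mulr_natr; ring.
rewrite -cisMn -cisN /cexp /cis /= !mul0r !mul1r sub0r oppr0 expR0.
by rewrite mul1r sub0r.
Qed.

(** * Factoring the symbol of I - theta nu L *)

Lemma prim_rootV (F : fieldType) (n : nat) (w : F) :
  n.-primitive_root w -> n.-primitive_root w^-1.
Proof.
move=> pw; have n0 := prim_order_gt0 pw.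
have -> : w^-1 = w ^+ n.-1.
  apply: (mulfI (prim_root_neq0 pw)).
  rewrite mulfV ?(prim_root_neq0 pw) // -exprS prednK //.
  by rewrite (prim_expr_order pw).
rewrite (prim_root_exp_coprime _ pw) coprime_sym -{1}(prednK n0).
exact: coprimeSn.
Qed.

(** The coefficient of z^q in 1 / ((1 - y z) (1 + y / z)), by partial fractions.
    The series of 1 / (1 + y / z) runs over negative powers of z, and
    z^q = z^-(n - q), so its coefficient is (-y)^(n - q) / (1 - (-y)^n), except
    for q = 0 where the exponent modulo n is 0; n odd gives
    1 - (-y)^n = 1 + y^n. *)
Lemma sum_symbol_inverse (F : fieldType) (n : nat) (w y : F) (q : 'I_n) :
  n.-primitive_root w -> odd n -> 1 + y ^+ 2 != 0 -> 1 - y ^+ n != 0 ->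
  1 + y ^+ n != 0 ->
  \sum_(l < n) ((1 - y * w ^+ l) * (1 + y / w ^+ l))^-1 * (w ^+ l) ^- q
  = n%:R / (1 + y ^+ 2) *
    (y ^+ q / (1 - y ^+ n)
     + (- y) ^+ (if q == 0 :> nat then 0 else n - q)%N / (1 + y ^+ n)
     - (q == 0 :> nat)%:R).
Proof.
move=> pw on y2 ym yp; have w0 := prim_root_neq0 pw.
have n0 := prim_order_gt0 pw; have pV := prim_rootV pw.
have d1 (l : 'I_n) : 1 - y * w ^+ l != 0.
  move: ym; rewrite -(prod_one_sub_prim_root y pw) => /prodf_neq0; exact.
have Nyn : (- y) ^+ n = - y ^+ n by rewrite exprNn -signr_odd on mulN1r.
have d2 (l : 'I_n) : 1 + y / w ^+ l != 0.
  move: yp; rewrite -[y ^+ n]opprK -Nyn -(prod_one_sub_prim_root (- y) pV).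
  by move=> /prodf_neq0 /(_ l isT); rewrite mulNr opprK exprVn.
have E (l : 'I_n) : ((1 - y * w ^+ l) * (1 + y / w ^+ l))^-1 * (w ^+ l) ^- q
   = (1 + y ^+ 2)^-1 * ((1 - y * w ^+ l)^-1 * (w ^+ l) ^- q
      + (1 + y / w ^+ l)^-1 * (w ^+ l) ^- q - (w ^+ l) ^+ 0 * (w ^+ l) ^- q).
  rewrite expr0 mul1r; move: ((w ^+ l) ^- q) => c.
  have := d1 l; have := d2 l; have : w ^+ l != 0 by rewrite expf_neq0.
  move: (w ^+ l) => z z0 H2 H1.
  field; apply/and4P; split => //.
  apply: contra H2 => /eqP H.
  by rewrite -(mulfK z0 (1 + _)) mulrDl mul1r divfK // H mul0r.
rewrite (eq_bigr _ (fun l _ => E l)) -mulr_sumr sumrB big_split /=.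
rewrite (prim_root_orthogonality (Ordinal n0) q pw).
rewrite sum_geometric_prim_root //; last by rewrite eq_sym -subr_eq0.
(* The second term is a geometric series for the primitive root [w^-1], read at
   the index that represents [- q] modulo n. *)
have hq : ((if q == 0 :> nat then 0 else n - q) < n)%N.
  by case: eqP => // /eqP; have := ltn_ord q; lia.
have -> : \sum_(l < n) (1 + y / w ^+ l)^-1 * (w ^+ l) ^- q
    = \sum_(l < n) (1 - (- y) * w^-1 ^+ l)^-1 * (w^-1 ^+ l) ^- Ordinal hq.
  apply: eq_bigr => l _; rewrite mulNr opprK exprVn; congr (_ * _).
  rewrite /= [in RHS]exprVn invrK.
  case: eqP => [->|_]; first by rewrite !expr0 invr1.
  have zq : (w ^+ l) ^+ q != 0 by rewrite !expf_neq0.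
  apply: (mulfI zq); rewrite mulfV // -exprD subnKC 1?ltnW //.
  by rewrite exprAC (prim_expr_order pw) expr1n.
rewrite sum_geometric_prim_root //; last by rewrite Nyn eq_sym -subr_eq0 opprK.
rewrite Nyn opprK /= eq_sym -val_eqE /=.
rewrite -[X in _ - X](mulrb) -[X in _ - X]mulr_natr.
ring.
Qed.

(** [2 L] is the shift minus its inverse.  Positivity of [k] makes the two
    neighbours of an index distinct. *)
Lemma has_symbol_Lmx (R : realType) (k : nat) (w : R[i]) : (0 < k)%N ->
  ((2 * k).+1).-primitive_root w ->
  has_symbol w (map_mx (real_complex R) (Lmx R k))
    (fun l => (w ^+ l - (w ^+ l)^-1) / 2).
Proof.
move=> k0 pw l; apply/matrixP => i c; rewrite !mxE.
set z := w ^+ l.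
have z0 : z != 0 by rewrite expf_neq0 ?(prim_root_neq0 pw).
have zn : z ^+ (2 * k).+1 = 1 by rewrite exprAC (prim_expr_order pw) expr1n.
have neq : ord_pred i != ordS i.
  rewrite -val_eqE /= addnS /= -(addn1 i) eqn_modDl !modn_small //; last by lia.
  by apply/eqP; lia.
have zS : z ^+ ordS i = z ^+ i * z by rewrite /= expr_mod // exprSr.
have zP : z ^+ ord_pred i = z ^+ i / z.
  rewrite /= expr_mod // addnS /= exprD; congr (_ * _).
  by apply: (mulfI z0); rewrite -exprS zn mulfV.
rewrite (bigD1 (ordS i)) //= (bigD1 (ord_pred i)) //= big1; last first.
  by move=> j /andP[/negPf j1 /negPf j2]; rewrite !mxE j1 j2 mul0r.
rewrite !mxE !eqxx (negPf neq) -/z zS zP addr0.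
rewrite !rmorphN !rmorphM /= fmorphV rmorph1 rmorph_nat.
by field.
Qed.

Lemma symbol_factor (F : fieldType) (t y z : F) : z != 0 -> 1 - y ^+ 2 != 0 ->
  (2%:R != 0 :> F) -> t * (1 - y ^+ 2) = 2 * y ->
  1 + - t * ((z - z^-1) / 2) = (1 - y * z) * (1 + y / z) / (1 - y ^+ 2).
Proof.
move=> z0 y2 n2 ty; have -> : t = 2 * y / (1 - y ^+ 2) by rewrite -ty mulfK.
by field; rewrite z0 y2.
Qed.

(** Tangent half-angle substitution: if t = tan(2 phi) then y = tan(phi), as
    t = 2 y / (1 - y^2).  Everything follows from y^2 = (s - 1) / (s + 1),
    that is 1 - y^2 = 2 / (s + 1). *)
Lemma tan_half_angle (R : rcfType) (t : R) : 0 < t ->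
  let s := Num.sqrt (1 + t ^+ 2) in let y := (s - 1) / t in
  [/\ 0 < y < 1, t * (1 - y ^+ 2) = 2 * y, (s + 1) / 2 = (1 - y ^+ 2)^-1
    & (s - 1) / 2 = y ^+ 2 / (1 - y ^+ 2)].
Proof.
move=> t0 s y.
have s2 : s ^+ 2 = 1 + t ^+ 2 by rewrite sqr_sqrtr // addr_ge0 ?sqr_ge0.
have tE : t ^+ 2 = (s - 1) * (s + 1) by rewrite -subr_sqr s2 expr1n; ring.
have s0 : 0 <= s by apply: sqrtr_ge0.
have s1 : 1 < s by nra.
have st : s < 1 + t by nra.
have y01 : 0 < y < 1.
  by rewrite divr_gt0 ?subr_gt0 //= ltr_pdivrMr // mul1r ltrBlDl.
have yE : y ^+ 2 = (s - 1) / (s + 1).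
  rewrite /y expr_div_n tE.
  by field; rewrite !gt_eqF //; lra.
have sp : s + 1 != 0 by rewrite gt_eqF //; lra.
have y2 : 1 - y ^+ 2 = 2 / (s + 1) by rewrite yE; field.
split => //.
- rewrite y2 /y; apply: (mulfI (lt0r_neq0 t0)).
  have -> : t * (t * (2 / (s + 1))) = t ^+ 2 * (2 / (s + 1)) by ring.
  rewrite tE.
  by field; rewrite sp lt0r_neq0.
- by rewrite y2 invf_div.
- by rewrite y2 yE; field.
Qed.

(** * Determinant and first row of M *)

Lemma has_symbol_affine_Lmx (R : realType) (k : nat) (w : R[i]) (a : R) :
  (0 < k)%N -> ((2 * k).+1).-primitive_root w ->
  has_symbol w (map_mx (real_complex R) (1%:M + a *: Lmx R k))
    (fun l => 1 + a%:C * ((w ^+ l - (w ^+ l)^-1) / 2)).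
Proof.
move=> k0 pw; rewrite map_mxD map_mx1 map_mxZ.
exact/has_symbol_affine/has_symbol_Lmx.
Qed.

Lemma calD_prod (R : realType) (k : nat) (w : R[i]) (theta nu : R) :
  (0 < k)%N -> ((2 * k).+1).-primitive_root w ->
  (calD theta nu k)%:C = \prod_(l < (2 * k).+1)
     (1 + (- (theta * nu))%:C * ((w ^+ l - (w ^+ l)^-1) / 2)).
Proof.
move=> k0 pw; rewrite -(has_symbol_det pw (has_symbol_affine_Lmx _ k0 pw)).
by rewrite det_map_mx /calD scaleNr.
Qed.

(** The factored symbol is multiplied over all roots of unity, once with [w] and
    once with [w^-1]; n odd turns 1 - (-y)^n into 1 + y^n. *)
Lemma calD_closed (R : realType) (k : nat) (theta nu y : R) : (0 < k)%N ->
  0 < y < 1 -> theta * nu * (1 - y ^+ 2) = 2 * y ->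
  calD theta nu k = (1 - y ^+ (2 * (2 * k).+1)) / (1 - y ^+ 2) ^+ (2 * k).+1.
Proof.
move=> k0 /andP[y0 y1] ty; set n := (2 * k).+1.
have pw : n.-primitive_root (cis (pi *+ 2 / n%:R : R)) by apply: cis_prim_root.
move: (cis _) pw => w pw; have pV := prim_rootV pw.
have y2 : 1 - y ^+ 2 != 0 by rewrite subr_eq0 eq_sym lt_eqF // expr_lt1 // ltW.
apply: (fmorph_inj (real_complex R)); rewrite [LHS](calD_prod _ _ k0 pw).
have E (l : 'I_n) : 1 + (- (theta * nu))%:C * ((w ^+ l - (w ^+ l)^-1) / 2)
   = (1 - y%:C * w ^+ l) * (1 - (- y)%:C * w^-1 ^+ l) * ((1 - y ^+ 2)^-1)%:C.
  rewrite !rmorphN /= (@symbol_factor _ _ y%:C) //.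
  2: by rewrite expf_neq0 ?(prim_root_neq0 pw).
  - by rewrite fmorphV rmorphB rmorph1 rmorphXn exprVn mulNr opprK.
  - by rewrite -rmorphXn -(rmorph1 (real_complex R)) -rmorphB fmorph_eq0.
  - by rewrite pnatr_eq0.
  - rewrite -rmorphXn -[1](rmorph1 (real_complex R)) -rmorphB -rmorphM ty.
    by rewrite rmorphM rmorph_nat.
rewrite (eq_bigr _ (fun l _ => E l)) !big_split /= prodr_const card_ord.
rewrite (prod_one_sub_prim_root _ pw) (prod_one_sub_prim_root _ pV).
transitivity ((1 - y ^+ n) * (1 - (- y) ^+ n) * (1 - y ^+ 2)^-1 ^+ n)%:C.
  by rewrite !(rmorphM, rmorphB, rmorphXn, rmorph1).
have on : odd n by rewrite /n oddS oddM.
congr (_%:C); rewrite exprVn exprNn -signr_odd on mulnC exprM.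
by congr (_ / _); ring.
Qed.

Lemma Mmx_entry_sum (R : realType) (k : nat) (w : R[i]) (theta nu : R)
    (q : 'I_(2 * k).+1) : (0 < k)%N -> ((2 * k).+1).-primitive_root w ->
  calD theta nu k != 0 ->
  (Mmx theta nu k ord0 q)%:C = (2 * k).+1%:R^-1 * \sum_(l < (2 * k).+1)
    (1 + ((1 - theta) * nu)%:C * ((w ^+ l - (w ^+ l)^-1) / 2)) /
    (1 + (- (theta * nu))%:C * ((w ^+ l - (w ^+ l)^-1) / 2)) * (w ^+ l) ^- q.
Proof.
move=> k0 pw D0.
have uA : 1%:M + - (theta * nu) *: Lmx R k \in unitmx.
  by rewrite scaleNr unitmxE unitfE.
have sM := has_symbol_mulV pw _ (has_symbol_affine_Lmx (- (theta * nu)) k0 pw)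
  (has_symbol_affine_Lmx ((1 - theta) * nu) k0 pw).
move: sM; rewrite map_unitmx => /(_ uA) sM.
have := has_symbol_entry ord0 q pw sM.
rewrite -map_invmx -map_mxM mxE /Mmx scaleNr => ->; congr (_ * _).
by apply: eq_bigr => l _; rewrite expr0 mulr1.
Qed.

(** M = (1 - 1/theta) I + A^-1 / theta, so the entry is the Fourier coefficient
    of a constant plus that of the inverse of the factored symbol. *)
Lemma Mmx_entry_closed (R : realType) (k : nat) (theta nu y : R)
    (q : 'I_(2 * k).+1) : (0 < k)%N -> theta != 0 ->
  0 < y < 1 -> theta * nu * (1 - y ^+ 2) = 2 * y ->
  let n := (2 * k).+1 in
  Mmx theta nu k ord0 q = (q == 0 :> nat)%:R * (1 - theta^-1)
   + theta^-1 * ((1 - y ^+ 2) / (1 + y ^+ 2)) *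
    (y ^+ q / (1 - y ^+ n) +
     (- y) ^+ (if q == 0 :> nat then 0 else n - q)%N / (1 + y ^+ n)
     - (q == 0 :> nat)%:R).
Proof.
move=> k0 th0 y01 ty n; have /andP[y0 y1] := y01.
have pw : n.-primitive_root (cis (pi *+ 2 / n%:R : R)) by apply: cis_prim_root.
have n1 : (n%:R : R[i]) != 0 by rewrite pnatr_eq0.
have n0 : (0 < n)%N by [].
have yn m : (0 < m)%N -> 1 - y ^+ m != 0.
  by move=> m0; rewrite subr_eq0 eq_sym lt_eqF // expr_lt1 // ltW.
have yp m : 1 + y ^+ m != 0 by rewrite lt0r_neq0 // addr_gt0 // exprn_gt0.
have D0 : calD theta nu k != 0.
  by rewrite (calD_closed k0 y01 ty) mulf_neq0 ?invr_eq0 ?expf_neq0 ?yn.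
move: (cis _) pw => w pw.
have two0 : (2 : R[i]) != 0 by rewrite pnatr_eq0.
apply: (fmorph_inj (real_complex R)); rewrite [LHS](Mmx_entry_sum _ k0 pw D0).
have [Y2 Yn Yp YM] : [/\ 1 - y%:C ^+ 2 != 0, 1 - y%:C ^+ n != 0,
    1 + y%:C ^+ n != 0 & 1 + y%:C ^+ 2 != 0].
  by rewrite -!(rmorphXn (real_complex R)) -!(rmorph1 (real_complex R))
   -!rmorphB -!rmorphD !fmorph_eq0 !yn // !yp.
have tyC : theta%:C * nu%:C * (1 - y%:C ^+ 2) = 2 * y%:C.
  rewrite -(rmorph_nat (real_complex R) 2) -(rmorph1 (real_complex R)).
  by rewrite -(rmorphXn (real_complex R)) -rmorphB -!rmorphM /= ty.
have thC : theta%:C != 0 by rewrite (fmorph_eq0 (real_complex R)).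
have sD (l : 'I_n) : 1 + (- (theta * nu))%:C * ((w ^+ l - (w ^+ l)^-1) / 2)
   = (1 - y%:C * w ^+ l) * (1 + y%:C / w ^+ l) / (1 - y%:C ^+ 2).
  rewrite rmorphN rmorphM /= (@symbol_factor _ _ y%:C) //.
  by rewrite expf_neq0 ?(prim_root_neq0 pw).
have dn0 (l : 'I_n) :
    1 + (- (theta * nu))%:C * ((w ^+ l - (w ^+ l)^-1) / 2) != 0.
  have : (calD theta nu k)%:C != 0 by rewrite (fmorph_eq0 (real_complex R)).
  by rewrite (calD_prod _ _ k0 pw) => /prodf_neq0 /(_ l isT).
have S0 : \sum_(l < n) (w ^+ l) ^- q = n%:R * (q == 0 :> nat)%:R.
  have := prim_root_orthogonality ord0 q pw.
  under eq_bigr => l _ do rewrite expr0 mul1r.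
  move=> ->; rewrite -val_eqE /= eq_sym.
  by case: eqP; rewrite ?mulr1 ?mulr0.
have E (l : 'I_n) :
    (1 + ((1 - theta) * nu)%:C * ((w ^+ l - (w ^+ l)^-1) / 2)) /
    (1 + (- (theta * nu))%:C * ((w ^+ l - (w ^+ l)^-1) / 2)) * (w ^+ l) ^- q
  = (1 - theta%:C^-1) * (w ^+ l) ^- q
    + theta%:C^-1 * (1 - y%:C ^+ 2) *
      (((1 - y%:C * w ^+ l) * (1 + y%:C / w ^+ l))^-1 * (w ^+ l) ^- q).
  have -> : ((1 - y%:C * w ^+ l) * (1 + y%:C / w ^+ l))^-1 =
      (1 - y%:C ^+ 2)^-1
      / (1 + (- (theta * nu))%:C * ((w ^+ l - (w ^+ l)^-1) / 2)).
    by rewrite sD invf_div mulKf.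
  have := dn0 l; rewrite !(rmorphN, rmorphM, rmorphB, rmorph1) /=.
  move: ((_ - _) / 2) ((w ^+ l) ^- q) => s c d0; field.
  by apply/and3P; split.
rewrite (eq_bigr _ (fun l _ => E l)) big_split -!mulr_sumr.
rewrite S0 sum_symbol_inverse //; last first.
  by rewrite /n oddS oddM.
rewrite rmorphD !rmorphM /= !fmorphV !rmorphB !rmorphD !rmorphXn /=.
rewrite !rmorphM /= !fmorphV !rmorphB !rmorphD !rmorphXn !rmorphN !rmorph1 /=.
rewrite !rmorph_nat /=.
rewrite -/n; set G := (_ + _ / _ - _); move: G (_ == _)%:R => G e.
by field; apply/and3P; split.
Qed.

Lemma MentryE (R : realType) (theta nu : R) (k j : nat) :
  Mentry theta nu k 1 j = Mmx theta nu k ord0 (inord j.-1).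
Proof.
by rewrite /Mentry; congr (Mmx _ _ _ _ _); apply: val_inj; rewrite /= inordK.
Qed.

Theorem corollary1 (R : realType) (theta nu : R) (k : nat)
    (theta_gt0 : 0 < theta) (nu_gt0 : 0 < nu) (k_gt0 : (0 < k)%N) :
  let y : R := (Num.sqrt (1 + theta ^+ 2 * nu ^+ 2) - 1) / (theta * nu) in
  let xi (l : nat) : R := 2 * pi * (l%:R - 1) / (2 * k + 1)%:R in
  let lam (l : nat) : R[i] :=
    (1 + 'i * (1 - theta)%:C * nu%:C * (sin (xi l))%:C)
      / (1 - 'i * theta%:C * nu%:C * (sin (xi l))%:C) in
  [/\ [/\ ((2 * k + 1)%:R)^-1 * \sum_(1 <= l < (2 * k + 1).+1) lam l
            = (Mentry theta nu k 1 1)%:C,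
          Mentry theta nu k 1 1 = calP theta nu 1 k / calD theta nu k
        & calP theta nu 1 k / calD theta nu k
            = (- theta * y ^+ (4 * k + 4) - (theta - 2) * y ^+ (4 * k + 2)
               + (theta - 2) * y ^+ 2 + theta)
              / ((1 + y ^+ 2) * (1 - y ^+ (4 * k + 2)) * theta)],
      forall j : nat, (2 <= j <= 2 * k + 1)%N ->
      [/\ ((2 * k + 1)%:R)^-1
            * \sum_(1 <= l < (2 * k + 1).+1)
                lam l * cexp (- 'i * (j%:R - 1) * (xi l)%:C)
            = (Mentry theta nu k 1 j)%:C,
          Mentry theta nu k 1 j = calP theta nu j k / calD theta nu k
        & calP theta nu j k / calD theta nu k
            = nu * (1 - y ^+ 2) ^+ 2
              / (2 * (1 + y ^+ 2) * (1 - y ^+ (4 * k + 2)))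
              * ((-1) ^+ (j - 1) * y ^+ (4 * k + 2 - j) + y ^+ (2 * k - 1 + j)
                 + (-1) ^+ j * y ^+ (2 * k + 1 - j) + y ^+ (j - 2))]
    & [/\ \prod_(1 <= l < (2 * k + 1).+1)
            (1 - 'i * theta%:C * nu%:C * (sin (xi l))%:C)
            = (calD theta nu k)%:C,
          calD theta nu k
            = ((Num.sqrt (1 + theta ^+ 2 * nu ^+ 2) + 1) / 2) ^+ (2 * k + 1)
              - ((Num.sqrt (1 + theta ^+ 2 * nu ^+ 2) - 1) / 2) ^+ (2 * k + 1)
        & calD theta nu k
            = (1 - y ^+ (4 * k + 2)) / (1 - y ^+ 2) ^+ (2 * k + 1)]].
Proof.
move=> y xi lam.
have [y01 ty sp sm] := tan_half_angle (mulr_gt0 theta_gt0 nu_gt0).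
rewrite exprMn -/y in y01 ty sp sm.
have th0 : theta != 0 by rewrite lt0r_neq0.
pose n := (2 * k).+1; have /andP[y0 y1] := y01.
have nE : (2 * k + 1 = n)%N by rewrite addn1.
have n2E : (4 * k + 2 = 2 * n)%N by rewrite /n; lia.
have n4E : (4 * k + 4 = 2 * n + 2)%N by rewrite /n; lia.
have yn m : (0 < m)%N -> 1 - y ^+ m != 0.
  by move=> m0; rewrite subr_eq0 eq_sym lt_eqF // expr_lt1 // ltW.
have yp m : 1 + y ^+ m != 0 by rewrite lt0r_neq0 // addr_gt0 // exprn_gt0.
have DE := calD_closed k_gt0 y01 ty.
have D0 : calD theta nu k != 0.
  by rewrite DE mulf_neq0 ?invr_eq0 ?expf_neq0 ?yn.
have PD j : calP theta nu j k / calD theta nu k = Mentry theta nu k 1 j.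
  by rewrite /calP mulrC mulKf.
have pw : n.-primitive_root (cis (pi *+ 2 / n%:R : R)) by apply: cis_prim_root.
set w := cis _ in pw.
have cis_xi l : cis (xi l.+1) = w ^+ l.
  rewrite -cisMn /xi nE; congr cis.
  by rewrite -[RHS]mulr_natr -(natr1 l) addrK mulrAC -(mulr_natl pi).
have isin l : 'i * (sin (xi l.+1))%:C = (w ^+ l - (w ^+ l)^-1) / 2.
  by rewrite sin_cis cis_xi.
have denE l : 1 - 'i * theta%:C * nu%:C * (sin (xi l.+1))%:C
    = 1 + (- (theta * nu))%:C * ((w ^+ l - (w ^+ l)^-1) / 2).
  by rewrite -isin rmorphN rmorphM /=; ring.
have lamE l : lam l.+1 =
    (1 + ((1 - theta) * nu)%:C * ((w ^+ l - (w ^+ l)^-1) / 2)) /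
    (1 + (- (theta * nu))%:C * ((w ^+ l - (w ^+ l)^-1) / 2)).
  by rewrite /lam denE -isin rmorphM /=; congr (_ / _); ring.
(* From here on the abbreviations enter only through the equations above; left
   transparent, they make unification unfold complex division. *)
clearbody w lam xi y.
rewrite nE n2E n4E; split.
- split; rewrite ?PD //.
    rewrite MentryE (Mmx_entry_sum _ k_gt0 pw D0) big_add1 big_mkord.
    congr (_ * _); apply: eq_bigr => l _.
    by rewrite lamE inordK // expr0 invr1 mulr1.
  rewrite MentryE (Mmx_entry_closed _ k_gt0 th0 y01 ty) inordK //= !expr0 -/n.
  have := yn n isT; have := yp n; have := yp 2%N; have := yn (2 * n)%N isT.
  rewrite exprD mulnC exprM; move: (y ^+ n) => Y h1 h2 h3 h4.
  by field; rewrite h1 h2 h3 h4 th0.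
- move=> j /andP[j2 jn].
  have jI : (j.-1 < n)%N by lia.
  have jR : j%:R - 1 = j.-1%:R :> R[i].
    by rewrite -[in LHS](prednK (ltnW j2)) -(natr1 j.-1) addrK.
  split; rewrite ?PD //.
    rewrite MentryE (Mmx_entry_sum _ k_gt0 pw D0) big_add1 big_mkord.
    congr (_ * _); apply: eq_bigr => l _.
    rewrite lamE inordK //; congr (_ * _).
    by rewrite jR cexp_cis cis_xi.
  rewrite MentryE (Mmx_entry_closed _ k_gt0 th0 y01 ty) inordK // -/n.
  (* Both j - 2 and n - j become free natural numbers [m] and [p], so that every
     exponent is a sum; m + p is odd, and the signs of the two forms agree. *)
  have [m jE] : exists m, j = m.+2 by exists j.-2; lia.
  have [p nmp] : exists p, n = (m + p + 2)%N by exists (n - m - 2)%N; lia.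
  have -> : (2 * n - j = n + p)%N by lia.
  have -> : (2 * k - 1 + j = n + m)%N.
    by rewrite jE; have : (2 * k = n.-1)%N by []; lia.
  have -> : (n - j = p)%N by lia.
  have -> : (j - 2 = m)%N by lia.
  have -> : (j - 1 = m.+1)%N by lia.
  rewrite jE /= subr0.
  have -> : (n - m.+1 = p.+1)%N by lia.
  have pm : (-1) ^+ p.+1 = (-1) ^+ m :> R.
    rewrite -signr_odd -[in RHS]signr_odd; congr (_ ^+ nat_of_bool _).
    have : odd n by rewrite /n oddS oddM.
    by rewrite nmp !oddD /=; case: (odd m); case: (odd p).
  rewrite (exprNn y) pm.
  have nuE : nu = 2 * y / (theta * (1 - y ^+ 2)).
    by rewrite -ty; field; rewrite th0 yn.
  have := yn n isT; have := yp n; have := yp 2%N; have := yn (2 * n)%N isT.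
  have := yn 2%N isT; rewrite nuE mulnC exprM !exprD.
  rewrite !(exprS _ m.+1) !(exprS _ m) !(exprS _ p).
  move: (y ^+ n) (y ^+ m) (y ^+ p) ((-1) ^+ m) => Y Ym Yp e h0 h1 h2 h3 h4.
  by field; rewrite h0 h1 h2 h3 h4 th0.
split => //.
- rewrite (calD_prod _ _ k_gt0 pw) big_add1 big_mkord.
  by apply: eq_bigr => l _; rewrite denE.
- rewrite DE sp sm exprVn expr_div_n -/n exprM.
  by rewrite mulrBl mul1r.
Qed.
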